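(* Fix integers $\Lambda\ge 1$, $N$, and a vector $\bm{K}_{\text{comb}}=(K_0,K_1,\dots,K_\Lambda)$ of non-negative integers, and let $K=\sum_{\lambda=0}^{\Lambda}K_\lambda\binom{\Lambda}{\lambda}$ with $N\ge K$. Consider the multi-access coded caching problem with $\Lambda$ caches and the generalized combinatorial topology given by $\bm{K}_{\text{comb}}$. Then, under uncoded cache placement, the optimal worst-case load $R^\star_{\text{comb}}(M)$, as a function of the cache size $M\in[0,N]$, is the piecewise linear curve with corner points \[ (M,R^\star_{\text{comb}})=\left(t\frac{N}{\Lambda},\ \sum_{\lambda=0}^{\Lambda-t}K_\lambda\frac{\binom{\Lambda}{t+\lambda}}{\binom{\Lambda}{t}}\right),\qquad t\in\{0,1,\dots,\Lambda\}. \]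
   Context: Multi-access coded caching model: a server holds a library of $N$ files $W_1,\dots,W_N$ of $B$ bits each; there are $\Lambda$ caches, each able to store $MB$ bits, and $K$ users with $N\ge K$. Each user $u$ is connected to a subset $\mathcal U_u\subseteq[\Lambda]=\{1,\dots,\Lambda\}$ of caches (possibly empty) and can read the full content of every cache in $\mathcal U_u$. In the placement phase, before demands are known, the server fills the caches. Placement is uncoded if each file $W_n$ is partitioned into disjoint subfiles $W_{n,\mathcal T}$, $\mathcal T\subseteq[\Lambda]$ (some possibly empty), and cache $\ell$ stores exactly the subfiles $W_{n,\mathcal T}$ with $\ell\in\mathcal T$ (for all $n$), subject to the total stored size being at most $MB$ bits per cache. In the delivery phase each user $u$ requests a file index $d_u\in[N]$; the server broadcasts over an error-free shared link a message $X$ (a function of the library and the demand vector), and each user $u$ must recover $W_{d_u}$ exactly from $X$ and the contents of the caches in $\mathcal U_u$. The (worst-case) load of a scheme is the maximum over all demand vectors of $|X|/B$. For a given topology known during both placement and delivery, the optimal worst-case load under uncoded placement $R^\star(M)$ is the infimum of loads achievable by such schemes with uncoded placement and cache size $M$. Generalized combinatorial topology with vector $(K_0,\dots,K_\Lambda)$: for every $\lambda\in\{0,\dots,\Lambda\}$ and every $\mathcal U\subseteq[\Lambda]$ with $|\mathcal U|=\lambda$, there are exactly $K_\lambda$ users whose set of connected caches is exactly $\mathcal U$ (so $K=\sum_\lambda K_\lambda\binom{\Lambda}{\lambda}$); its optimal load is denoted $R^\star_{\text{comb}}$. A ''piecewise linear curve with corner points $(M_t,R_t)$'' is the function obtained by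 linear interpolation between consecutive points $(M_t,R_t),(M_{t+1},R_{t+1})$. Convention: $\binom{n}{k}=0$ if $n<0$, $k<0$ or $n<k$. *)

(* Defs.v *)
From HB Require Import structures.
From mathcomp Require Import all_boot all_order all_algebra.
From mathcomp Require Import reals.
Set Implicit Arguments. Unset Strict Implicit. Unset Printing Implicit Defensive.
Import Order.TTheory GRing.Theory Num.Theory.
Local Open Scope ring_scope.

Definition library (N B : nat) := 'I_N -> 'I_B -> bool.

(* Uncoded placement: bit i of file n belongs to subfile W_{n,T} with
   T = p n i (so the subfiles W_{n,T}, T subset of [Lambda], partition W_n). *)
Definition placement (N B L : nat) := 'I_N -> 'I_B -> {set 'I_L}.

Definition cache_content N B L (p : placement N B L) (W : library N B) (l : 'I_L)
  : 'I_N -> 'I_B -> option bool :=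
  fun n i => if l \in p n i then Some (W n i) else None.

Definition cache_size N B L (p : placement N B L) (l : 'I_L) : nat :=
  #|[set x : 'I_N * 'I_B | l \in p x.1 x.2]|.

Definition user_view N B L (p : placement N B L) (W : library N B) (U : {set 'I_L})
  : 'I_L -> option ('I_N -> 'I_B -> option bool) :=
  fun l => if l \in U then Some (cache_content p W l) else None.

Definition deliverable N B L K (p : placement N B L) (conn : 'I_K -> {set 'I_L})
  (d : {ffun 'I_K -> 'I_N}) (Lx : nat) : Prop :=
  exists (enc : library N B -> 'I_Lx -> bool)
         (dec : 'I_K -> ('I_Lx -> bool) ->
                ('I_L -> option ('I_N -> 'I_B -> option bool)) -> 'I_B -> bool),
    forall (W : library N B) (u : 'I_K) (i : 'I_B),
      dec u (enc W) (user_view p W (conn u)) i = W (d u) i.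

Definition achievable_load (R : realType) (L N K : nat) (conn : 'I_K -> {set 'I_L})
  (M : R) (r : R) : Prop :=
  exists (B : nat) (p : placement N B L) (Ls : {ffun 'I_K -> 'I_N} -> nat),
    (0 < B)%N /\
    (forall l : 'I_L, (cache_size p l)%:R <= M * B%:R) /\
    (forall d, deliverable p conn d (Ls d)) /\
    r = (\max_(d : {ffun 'I_K -> 'I_N}) Ls d)%:R / B%:R.

Definition is_inf (R : realType) (S : R -> Prop) (r : R) : Prop :=
  (forall x, S x -> r <= x) /\ (forall e : R, 0 < e -> exists x, S x /\ x < r + e).

Definition cornerM (R : realType) (L N t : nat) : R := t%:R * N%:R / L%:R.
Definition cornerR (R : realType) (L : nat) (Kv : nat -> nat) (t : nat) : R :=
  \sum_(0 <= l < (L - t).+1) (Kv l)%:R * 'C(L, t + l)%:R / 'C(L, t)%:R.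

Definition interp (R : realType) (L N : nat) (Kv : nat -> nat) (t : nat) (M : R) : R :=
  @cornerR R L Kv t + (M - @cornerM R L N t) / (@cornerM R L N t.+1 - @cornerM R L N t)
                     * (@cornerR R L Kv t.+1 - @cornerR R L Kv t).

(* Main.v *)
(* Converse. Fix an ordering s of the caches and let the users decode in the order
   in which s exhausts their caches: from the message and the caches of all users
   read so far, a user still lacks the bits of its file that are cached only
   strictly later in s. These bits are determined by the message, so they are at
   most as many as the message bits. Averaging over all orderings and over N cyclic
   shifts of the demands, a bit stored in a set of t caches contributes the corner
   value c(t); since c is convex and nonincreasing, the memory constraint turns
   this into the chord of c through t and t + 1.

   Achievability. At a corner point every t-set T of caches stores the same number
   of bits of each file, and for each S the bits of the parts S minus U requested
   by the users with caches U inside S are added up; a user with caches U owns all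
   terms but its own, as it meets S minus U' whenever U' differs from U and has the
   same size. Between two corners the files are split in a rational proportion close
   to the required one. *)
Require Import Defs.
From HB Require Import structures.
From mathcomp Require Import all_boot all_order all_algebra perm.
From mathcomp Require Import boolp reals ring lra zify.
Set Implicit Arguments. Unset Strict Implicit. Unset Printing Implicit Defensive.
Import Order.TTheory GRing.Theory Num.Theory.
Local Open Scope ring_scope.

(** * Cache orderings *)

Lemma sum_nat_by_card (T : finType) (h : nat -> nat) :
  (\sum_(S : {set T}) h #|S| = \sum_(0 <= n < #|T|.+1) 'C(#|T|, n) * h n)%N.
Proof.
rewrite big_mkord (partition_big (fun S : {set T} => inord #|S| : 'I_#|T|.+1) xpredT) //=.
apply: eq_bigr => n _; rewrite -card_draws -[#|[set A : {set T} | _]|]sum1_card big_distrl /=.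
rewrite (eq_bigl (fun S => S \in [set A : {set T} | #|A| == n])); last first.
  move=> S; rewrite !inE -val_eqE /= inordK // ltnS; exact: max_card.
by apply: eq_bigr => S; rewrite inE mul1n => /eqP ->.
Qed.

(** A set followed by its complement enumerates [T]; matching equal positions of the two
    enumerations sends first block onto first block. *)
Lemma perm_imset_eq (T : finType) (A B : {set T}) :
  #|A| = #|B| -> exists s : {perm T}, s @: A = B.
Proof.
move=> eqAB.
pose f (X : {set T}) := enum X ++ enum (~: X).
have f_uniq X : uniq (f X).
  rewrite cat_uniq !enum_uniq /= andbT; apply/hasPn => x.
  by rewrite !mem_enum inE.
have f_mem X x : x \in f X by rewrite mem_cat !mem_enum inE orbN.
have f_size X : size (f X) = #|T| by rewrite size_cat -!cardE cardsC.
pose g x := nth x (f B) (index x (f A)).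
have ltB x : (index x (f A) < size (f B))%N by rewrite f_size -(f_size A) index_mem.
have g_inj : injective g.
  move=> x y; rewrite /g (set_nth_default y) // => /eqP.
  rewrite nth_uniq // => /eqP e.
  by rewrite -(nth_index x (f_mem A x)) e nth_index.
exists (perm g_inj); apply/eqP; rewrite eqEcard card_imset ?eqAB ?leqnn ?andbT; last exact: perm_inj.
apply/subsetP => _ /imsetP[x xA ->]; rewrite permE /g.
have lt : (index x (f A) < size (enum B))%N.
  by rewrite -cardE -eqAB index_cat mem_enum xA cardE index_mem mem_enum.
by rewrite nth_cat lt -mem_enum mem_nth.
Qed.

(** Vacuous when either set is empty: a user without caches lacks every bit, and a bit stored
    nowhere is lacking to every user. *)
Definition set_before (n : nat) (U T : {set 'I_n}) : bool :=
  [forall x in U, forall y in T, (x < y)%N].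

Lemma set_beforeP n (U T : {set 'I_n}) :
  reflect (forall x y, x \in U -> y \in T -> (x < y)%N) (set_before U T).
Proof.
apply: (iffP forall_inP) => [H x y xU yT|H x xU]; first exact: (forall_inP (H x xU)).
by apply/forall_inP => y yT; apply: H.
Qed.

(* Cutting an (l + t)-set after its l smallest elements is injective. *)
Lemma leq_card_before n l t :
  ('C(n, l + t) <= \sum_(T : {set 'I_n} | #|T| == t)
      #|[set U : {set 'I_n} | (#|U| == l) && set_before U T]|)%N.
Proof.
pose lo (S : {set 'I_n}) := [set x in take l (enum S)].
pose hi (S : {set 'I_n}) := [set x in drop l (enum S)].
have loU S : lo S :|: hi S = S.
  by apply/setP => x; rewrite !inE -mem_cat cat_take_drop mem_enum.
rewrite -{1}(card_ord n) -card_draws.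
set D := [set A : {set 'I_n} | _].
have inj : {in D &, injective (fun S => (lo S, hi S))}.
  by move=> S S' _ _ [e1 e2]; rewrite -(loU S) e1 e2 loU.
rewrite -(card_in_imset inj).
under eq_bigr => T _ do rewrite -sum1_card.
rewrite pair_big_dep /= -sum1_card big_mkcond [X in (_ <= X)%N]big_mkcond /=.
rewrite [X in (_ <= X)%N](reindex (fun x : {set 'I_n} * {set 'I_n} => (x.2, x.1))); last first.
  by exists (fun x : {set 'I_n} * {set 'I_n} => (x.2, x.1)) => -[].
apply: leq_sum => -[U T] _ /=; rewrite !inE.
case: ifP => // /imsetP[S]; rewrite inE => /eqP cS [-> ->].
have sz : size (enum S) = (l + t)%N by rewrite -cardE.
have un : uniq (enum S) by exact: enum_uniq.
rewrite !cardsE !(card_uniqP _) ?take_uniq ?drop_uniq //.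
rewrite size_drop sz addKn eqxx size_takel ?sz ?leq_addr // eqxx /=.
suff -> : set_before (lo S) (hi S) by [].
(* [enum S] inherits the increasing order of the ordinals, so all of [take] lies below all of
   [drop]. *)
have : pairwise (fun x y : 'I_n => (x < y)%N) (enum S).
  rewrite -sorted_pairwise; last by move=> y x z; apply: ltn_trans.
  rewrite /enum_mem sorted_filter //; first by move=> y x z; apply: ltn_trans.
  have := iota_ltn_sorted 0 n; rewrite -val_enum_ord sorted_map enumT.
  by [].
rewrite -{1}(cat_take_drop l (enum S)) pairwise_cat => /andP[/allrelP H _].
by apply/set_beforeP => x y; rewrite !inE; apply: H.
Qed.

(** The sum on the right depends on [T] only through [#|T|], so it may be summed over all sets of
    that size; a fixed [s] merely permutes these sets, and [leq_card_before] applies. *)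
Lemma leq_perm_before n l (T : {set 'I_n}) :
  (n`! * 'C(n, l + #|T|) <=
   'C(n, #|T|) * \sum_(U : {set 'I_n} | #|U| == l)
      #|[set s : {perm 'I_n} | set_before (s @: U) (s @: T)]|)%N.
Proof.
pose g (T : {set 'I_n}) := #|[set U : {set 'I_n} | (#|U| == l) && set_before U T]|.
pose h (T : {set 'I_n}) := (\sum_(s : {perm 'I_n}) g (s @: T))%N.
have hE (T0 : {set 'I_n}) : (\sum_(U : {set 'I_n} | #|U| == l)
      #|[set s : {perm 'I_n} | set_before (s @: U) (s @: T0)]| = h T0)%N.
  under eq_bigr => U _ do rewrite -sum1dep_card big_mkcond.
  rewrite exchange_big /=; apply: eq_bigr => s _.
  rewrite /g -sum1dep_card [RHS](reindex (fun U : {set 'I_n} => s @: U)) /=; last first.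
    exists (fun U : {set 'I_n} => s^-1%g @: U) => U _.
      by rewrite -imset_comp (eq_imset _ (g := id)) ?imset_id // => x /=; rewrite permK.
    by rewrite -imset_comp (eq_imset _ (g := id)) ?imset_id // => x /=; rewrite permKV.
  rewrite -big_mkcondr; apply: eq_bigl => U; rewrite card_imset //; exact: perm_inj.
have h_card (T1 T2 : {set 'I_n}) : #|T1| = #|T2| -> h T1 = h T2.
  case/perm_imset_eq => s <-; rewrite /h (reindex_inj (mulgI s)); apply: eq_bigr => r _.
  rewrite -imset_comp; congr g; apply: eq_imset => x /=; by rewrite permM.
set D := [set A : {set 'I_n} | #|A| == #|T|].
have -> : 'C(n, #|T|) = #|D| by rewrite card_draws card_ord.
rewrite hE -[#|D|]sum1_card big_distrl /=.
rewrite (eq_bigr h); last first.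
  by move=> T1; rewrite inE mul1n => /eqP e; apply: h_card.
rewrite exchange_big /= -card_Sn -sum1_card big_distrl /=.
apply: leq_sum => s _; rewrite mul1n; apply: leq_trans (leq_card_before _ _ _) _.
rewrite (reindex (fun U : {set 'I_n} => s @: U)) /=; last first.
  exists (fun U : {set 'I_n} => s^-1%g @: U) => U _.
    by rewrite -imset_comp (eq_imset _ (g := id)) ?imset_id // => x /=; rewrite permK.
  by rewrite -imset_comp (eq_imset _ (g := id)) ?imset_id // => x /=; rewrite permKV.
rewrite (eq_bigl (fun T0 => T0 \in D)) //.
by move=> T0; rewrite inE card_imset //; exact: perm_inj.
Qed.

(** * Convexity of the corner values *)

(** The right side minus the left is exactly the sum of the products [h1] to [h4]. *)
Lemma convex_decr_mul (R : realDomainType) (a0 a1 a2 b0 b1 b2 : R) :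
  0 <= a2 -> a2 <= a1 -> a1 <= a0 -> 2 * a1 <= a0 + a2 ->
  0 <= b2 -> b2 <= b1 -> b1 <= b0 -> 2 * b1 <= b0 + b2 ->
  2 * (a1 * b1) <= a0 * b0 + a2 * b2.
Proof.
move=> a2p a21 a10 ca b2p b21 b10 cb.
have h1 : 0 <= a1 * (b0 + b2 - 2 * b1) by apply: mulr_ge0; lra.
have h2 : 0 <= b1 * (a0 + a2 - 2 * a1) by apply: mulr_ge0; lra.
have h3 : 0 <= (a0 - a1) * (b0 - b1) by apply: mulr_ge0; lra.
have h4 : 0 <= (a1 - a2) * (b1 - b2) by apply: mulr_ge0; lra.
lra.
Qed.

(** The coefficient of [Kv l] in the corner value at [t]. *)
Definition binom_ratio (R : realFieldType) (L l t : nat) : R :=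
  'C(L, t + l)%:R / 'C(L, t)%:R.

(** Prepares an induction on [l]: the new factor depends on [t + l] alone. *)
Lemma binom_ratioS (R : realFieldType) (L l t : nat) :
  binom_ratio R L l.+1 t = binom_ratio R L l t * ((L - (t + l))%:R / (t + l).+1%:R).
Proof.
rewrite /binom_ratio addnS.
have e : (t + l).+1%:R * 'C(L, (t + l).+1)%:R = (L - (t + l))%:R * 'C(L, t + l)%:R :> R.
  by rewrite -!natrM mul_bin_left.
have -> : 'C(L, (t + l).+1)%:R = (L - (t + l))%:R * 'C(L, t + l)%:R / (t + l).+1%:R :> R.
  by rewrite -e mulrAC mulfV ?mul1r ?pnatr_eq0.
ring.
Qed.

Lemma div_natSr_le (R : realFieldType) (x y s : nat) :
  (y <= x)%N -> y%:R / s.+2%:R <= x%:R / s.+1%:R :> R.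
Proof.
move=> yx; rewrite ler_pdivrMr ?ltr0n // mulrAC ler_pdivlMr ?ltr0n //.
by rewrite -!natrM ler_nat; apply: leq_mul.
Qed.

(** Without truncation, [(L - s) / (s + 1)] is [(L + 1) / (s + 1) - 1], and the reciprocal is
    convex. If [L <= s.+1], the middle term vanishes. *)
Lemma sub_div_convex (R : realFieldType) (L s : nat) :
  2 * ((L - s.+1)%:R / s.+2%:R) <= (L - s)%:R / s.+1%:R + (L - s.+2)%:R / s.+3%:R :> R.
Proof.
have [Ls|sL] := leqP L s.+1.
  have /eqP -> : (L - s.+1 == 0)%N by rewrite subn_eq0.
  by rewrite mul0r mulr0 addr_ge0 // divr_ge0 // ler0n.
rewrite !natrB; try lia.
have frac (k : nat) : (L%:R - k%:R) / k.+1%:R = (L%:R + 1) * k.+1%:R^-1 - 1 :> R.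
  have : k.+1%:R != 0 :> R by rewrite pnatr_eq0.
  by rewrite -natr1 => k0; field.
rewrite !frac.
suff h : 2 * (s.+2%:R^-1) <= s.+1%:R^-1 + s.+3%:R^-1 :> R.
  move: (s.+1%:R^-1) (s.+2%:R^-1) (s.+3%:R^-1) h => x y z h.
  have L1 : 0 <= L%:R + 1 :> R by rewrite addr_ge0.
  nra.
have -> : s.+1%:R = s.+2%:R - 1 :> R by rewrite -(natr1 s.+1) addrK.
have -> : s.+3%:R = s.+2%:R + 1 :> R by rewrite natr1.
have : 1 < s.+2%:R :> R by rewrite ltr1n.
move: (s.+2%:R) => x x1.
rewrite -subr_ge0.
have -> : (x - 1)^-1 + (x + 1)^-1 - 2 * x^-1 = 2 / (x * (x - 1) * (x + 1)).
  by field; do ![apply/andP; split]; apply/eqP => h; lra.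
by apply: divr_ge0 => //; do ![apply: mulr_ge0]; lra.
Qed.

(** Convexity alone does not pass to products; together with sign and monotonicity it does, hence
    the joint induction. *)
Lemma binom_ratio_shape (R : realFieldType) (L l t : nat) : (t.+2 <= L)%N ->
  [/\ 0 <= binom_ratio R L l t.+2, binom_ratio R L l t.+2 <= binom_ratio R L l t.+1,
      binom_ratio R L l t.+1 <= binom_ratio R L l t &
      2 * binom_ratio R L l t.+1 <= binom_ratio R L l t + binom_ratio R L l t.+2].
Proof.
move=> tL; elim: l => [|l [IH0 IH1 IH2 IH3]].
  have b1 s : (s <= L)%N -> binom_ratio R L 0 s = 1.
    by move=> sL; rewrite /binom_ratio addn0 mulfV // pnatr_eq0 -lt0n bin_gt0.
  by rewrite !b1 ?(ltnW tL) ?(ltnW (ltnW tL)) //; split; lra.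
rewrite !binom_ratioS !addSn.
have q0 : 0 <= (L - (t + l).+2)%:R / (t + l).+3%:R :> R by rewrite divr_ge0.
have q1 : (L - (t + l).+2)%:R / (t + l).+3%:R <= (L - (t + l).+1)%:R / (t + l).+2%:R :> R.
  by apply: div_natSr_le; lia.
have q2 : (L - (t + l).+1)%:R / (t + l).+2%:R <= (L - (t + l))%:R / (t + l).+1%:R :> R.
  by apply: div_natSr_le; lia.
have q3 := sub_div_convex R L (t + l).
split; first exact: mulr_ge0.
- exact: ler_pM.
- by apply: ler_pM => //; [exact: le_trans IH1|exact: le_trans q1].
- exact: convex_decr_mul.
Qed.

(** The added terms have zero binomials; a range free of [t] lets corner values be compared term by
    term. *)
Lemma cornerRE (R : realType) (L : nat) (Kv : nat -> nat) (t : nat) :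
  @cornerR R L Kv t = \sum_(0 <= l < L.+1) (Kv l)%:R * binom_ratio R L l t.
Proof.
rewrite /cornerR [RHS](big_cat_nat (n := (L - t).+1)) //=; last by rewrite ltnS leq_subr.
rewrite [X in _ = _ + X]big1_seq ?addr0; last first.
  move=> l; rewrite mem_index_iota => /andP[_ /andP[h _]].
  by rewrite /binom_ratio bin_small ?mul0r ?mulr0 //; lia.
by apply: eq_bigr => l _; rewrite /binom_ratio mulrA.
Qed.

Lemma cornerR_shape (R : realType) (L : nat) (Kv : nat -> nat) (t : nat) : (t.+2 <= L)%N ->
  @cornerR R L Kv t.+1 - @cornerR R L Kv t <= @cornerR R L Kv t.+2 - @cornerR R L Kv t.+1.
Proof.
move=> tL; rewrite !cornerRE -!sumrB; apply: ler_sum => l _.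
rewrite -!mulrBr; apply: ler_wpM2l => //.
by have [_ _ _] := @binom_ratio_shape R L l t tL; lra.
Qed.

Lemma cornerR_decr (R : realType) (L : nat) (Kv : nat -> nat) (t : nat) : (t < L)%N ->
  @cornerR R L Kv t.+1 <= @cornerR R L Kv t.
Proof.
move=> tL; rewrite !cornerRE; apply: ler_sum => l _.
apply: ler_wpM2l => //.
have [t2|] := leqP t.+2 L; first by have [] := @binom_ratio_shape R L l t t2.
(* The last interval is out of reach of [binom_ratio_shape]: for [l = 0] both ratios are 1,
   otherwise the ratio at [t.+1] is 0. *)
rewrite ltnS => Lt; have -> : L = t.+1 by lia.
case: l => [|l]; last first.
  by rewrite {1}/binom_ratio bin_small ?mul0r ?divr_ge0 //; lia.
by rewrite /binom_ratio !addn0 !mulfV // pnatr_eq0 -lt0n bin_gt0.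
Qed.

Lemma convex_tangent (R : realDomainType) (L : nat) (c : nat -> R) :
  (forall k, (k.+2 <= L)%N -> c k.+1 - c k <= c k.+2 - c k.+1) ->
  forall t s, (t < L)%N -> (s <= L)%N ->
  c t + (s%:R - t%:R) * (c t.+1 - c t) <= c s.
Proof.
move=> cvx t s tL sL.
have mono k m : (k + m < L)%N -> c k.+1 - c k <= c (k + m).+1 - c (k + m)%N.
  elim: m => [|m IH] h; first by rewrite addn0.
  apply: le_trans (IH _) _; first lia.
  by rewrite !addnS; apply: cvx; lia.
have [ts|st] := leqP t s.
  rewrite -(subnKC ts) in sL *; move: (s - t)%N sL => m.
  rewrite natrD addrAC subrr add0r.
  elim: m => [|m IH] h; first by rewrite addn0 mul0r addr0.
  have := IH ltac:(lia); have := mono t m ltac:(lia).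
  rewrite addnS -natr1; lra.
have -> : t = (s + (t - s))%N by lia.
have : (s + (t - s) < L)%N by lia.
move: (t - s)%N => m; rewrite natrD.
elim: m => [|m IH] h; first by rewrite addn0; lra.
have := IH ltac:(lia).
have := cvx (s + m)%N ltac:(lia).
rewrite !addnS -natr1 => h1 h2.
(* Moving the chord one index to the right lowers its value at [s] by [m.+1] times the second
   difference. *)
have : 0 <= m.+1%:R * (c (s + m).+2 - c (s + m).+1 - (c (s + m).+1 - c (s + m)%N)).
  by apply: mulr_ge0 => //; lra.
rewrite -natr1; lra.
Qed.

(** * Converse bound *)

(* The bits counted on the left are recovered user by user, by induction on the
   number of caches up to the last one of the user in the order [s]. *)
Lemma deliverable_leq N B L K (p : placement N B L) (conn : 'I_K -> {set 'I_L})
    (d : {ffun 'I_K -> 'I_N}) (Lx : nat) (s : {perm 'I_L}) :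
  injective d -> deliverable p conn d Lx ->
  (\sum_(u < K) \sum_(i < B) set_before (s @: conn u) (s @: p (d u) i) <= Lx)%N.
Proof.
move=> d_inj [enc [dec decP]].
pose bef u i := set_before (s @: conn u) (s @: p (d u) i).
have befP u i : reflect (forall x y, x \in conn u -> y \in p (d u) i -> (s x < s y)%N) (bef u i).
  apply: (iffP (set_beforeP _ _)) => [H x y xu yp|H _ _ /imsetP[x xu ->] /imsetP[y yp ->]].
    by apply: H; apply: imset_f.
  exact: H.
pose A := [set (d vi.1, vi.2) | vi in [set vi : 'I_K * 'I_B | bef vi.1 vi.2]].
have cA : (\sum_(u < K) \sum_(i < B) bef u i)%N = #|A|.
  rewrite card_imset; last by move=> [u i] [v j] /= [/d_inj -> ->].
  rewrite pair_big /= -sum1_card [RHS]big_mkcond; apply: eq_bigr => -[u i] _.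
  by rewrite inE /=; case: (bef u i).
(* A subset of [A] is read as the library whose one-bits it marks. If the message determines the
   subset, then [2 ^ #|A|] is at most [2 ^ Lx]. *)
rewrite {}cA; pose lib (X : {set 'I_N * 'I_B}) : library N B := fun n i => (n, i) \in X.
pose f (X : {set 'I_N * 'I_B}) := [ffun q => enc (lib X) q].
have f_inj : {in powerset A &, injective f}.
  move=> X Y; rewrite !inE => XA YA fXY.
  have encE : enc (lib X) = enc (lib Y).
    by apply: funext => q; move/ffunP/(_ q): fXY; rewrite !ffunE.
  pose F u := [set x | [exists y in conn u, (s x <= s y)%N]].
  have agree : forall n u, (#|F u| <= n)%N -> lib X (d u) = lib Y (d u).
    elim=> [|n IH] u Fu.
      have U0 : conn u = set0.
        apply/setP => y; rewrite inE; apply/negP => yu.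
        move: Fu; rewrite leqn0 cards_eq0 => /eqP /setP/(_ y); rewrite !inE.
        by move/negbT/negP; apply; apply/exists_inP; exists y.
      apply: funext => i; rewrite -!(decP _ u) encE; congr (dec u _ _ i).
      by apply: funext => l; rewrite /user_view U0 inE.
    apply: funext => i; rewrite -!(decP _ u) encE; congr (dec u _ _ i).
    apply: funext => l; rewrite /user_view; case: ifP => // lu; congr Some.
    apply: funext => m; apply: funext => j; rewrite /cache_content.
    case: ifP => // lp; congr Some.
    (* Outside [A] both libraries are zero. A bit of [A] in cache [l] of [u] is wanted by some [v]
       whose caches all precede [l], so [F v] misses [l] and is a proper subset of [F u]. *)
    have [|nA] := boolP ((m, j) \in A); last first.
      rewrite /lib; transitivity false; first by apply: contraNF nA => /(subsetP XA).
      by symmetry; apply: contraNF nA => /(subsetP YA).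
    case/imsetP => -[v k]; rewrite inE /= => /befP bv [mE jE]; subst m k.
    rewrite (IH v) // -ltnS; apply: leq_trans Fu; apply: proper_card.
    apply/properP; split.
      apply/subsetP => x; rewrite !inE => /exists_inP[y yv xy].
      apply/exists_inP; exists l => //; apply: leq_trans xy _; apply: ltnW; exact: bv.
    exists l; first by rewrite inE; apply/exists_inP; exists l.
    rewrite inE; apply/exists_inP => -[y yv]; rewrite leqNgt; case/negP; exact: bv.
  apply/setP => -[m j]; have [|nA] := boolP ((m, j) \in A); last first.
    transitivity false; first by apply: contraNF nA => /(subsetP XA).
    by symmetry; apply: contraNF nA => /(subsetP YA).
  case/imsetP => -[v k]; rewrite inE /= => _ [-> ->].
  exact: (congr1 (fun g => g k) (agree _ v (leqnn _))).
have := max_card (mem (f @: powerset A)).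
by rewrite card_in_imset // card_powerset card_ffun card_bool card_ord leq_exp2l.
Qed.

Section Converse.
Variables (L N K : nat) (Kv : nat -> nat) (conn : 'I_K -> {set 'I_L}).
Hypothesis connE : forall U : {set 'I_L}, #|[set u | conn u == U]| = Kv #|U|.

Lemma sum_users (h : {set 'I_L} -> nat) :
  (\sum_(u < K) h (conn u) = \sum_(0 <= l < L.+1) Kv l * \sum_(U : {set 'I_L} | #|U| == l) h U)%N.
Proof.
rewrite (partition_big conn xpredT) //=.
rewrite (partition_big (fun U : {set 'I_L} => inord #|U| : 'I_L.+1) xpredT) //=.
rewrite big_mkord; apply: eq_bigr => l _; rewrite big_distrr /=.
have cle (U : {set 'I_L}) : (#|U| < L.+1)%N by rewrite ltnS -[X in (_ <= X)%N]card_ord max_card.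
apply: eq_big => [U|U]; rewrite -val_eqE /= inordK // => /eqP cU.
rewrite -cU -connE -sum1dep_card big_distrl /=.
by apply: eq_bigr => u /eqP ->; rewrite mul1n.
Qed.

(** Grouping users by their number [l] of caches makes each group an instance of
    [leq_perm_before]. *)
Lemma sum_perm_users (R : realType) (T : {set 'I_L}) :
  L`!%:R * cornerR R L Kv #|T| <=
  (\sum_(s : {perm 'I_L}) \sum_(u < K) set_before (s @: conn u) (s @: T))%:R.
Proof.
rewrite exchange_big /=.
rewrite (eq_bigr (fun u => #|[set s : {perm 'I_L} | set_before (s @: conn u) (s @: T)]|)); last first.
  move=> u _; rewrite -sum1dep_card [RHS]big_mkcond; apply: eq_bigr => s _.
  by case: (set_before _ _).
rewrite (sum_users (fun U => #|[set s : {perm 'I_L} | set_before (s @: U) (s @: T)]|)).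
rewrite cornerRE big_distrr natr_sum /=; apply: ler_sum => l _.
rewrite natrM /= mulrCA; apply: ler_wpM2l => //.
rewrite /binom_ratio mulrA ler_pdivrMr; last first.
  by rewrite ltr0n bin_gt0 -[X in (_ <= X)%N]card_ord max_card.
by rewrite -!natrM ler_nat addnC mulnC [X in (_ <= X)%N]mulnC mulnC leq_perm_before.
Qed.

Lemma converse_sum (R : realType) (B : nat) (p : placement N B L)
    (Ls : {ffun 'I_K -> 'I_N} -> nat) :
  (K <= N)%N -> (0 < N)%N -> (forall d, deliverable p conn d (Ls d)) ->
  \sum_(n < N) \sum_(i < B) cornerR R L Kv #|p n i| <= N%:R * (\max_d Ls d)%:R.
Proof.
case: N p Ls => // N' p Ls KN _ Hd.
(* Addition in ['I_N'.+1] is cyclic: each shift demands distinct files, and over all shifts every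
   user asks for every file exactly once. *)
pose sh (x : 'I_N'.+1) : {ffun 'I_K -> 'I_N'.+1} := [ffun u => widen_ord KN u + x].
have sh_inj x : injective (sh x).
  move=> u v; rewrite !ffunE => /addIr /(congr1 val) /= /val_inj; exact.
have bound : (\sum_(n < N'.+1) \sum_(i < B) \sum_(s : {perm 'I_L}) \sum_(u < K)
     set_before (s @: conn u) (s @: p n i) <= L`! * (N'.+1 * \max_d Ls d))%N.
  under [X in (X <= _)%N]eq_bigr => n _ do rewrite exchange_big.
  rewrite exchange_big /= -card_Sn -sum1_card big_distrl /=.
  apply: leq_sum => s _; rewrite mul1n.
  under [X in (X <= _)%N]eq_bigr => n _ do rewrite exchange_big.
  rewrite exchange_big /=.
  rewrite (eq_bigr (fun u => \sum_(x < N'.+1) \sum_(i < B)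
     set_before (s @: conn u) (s @: p (sh x u) i)))%N; last first.
    move=> u _; rewrite (reindex_inj (addrI (widen_ord KN u))).
    by apply: eq_bigr => x _; rewrite ffunE.
  rewrite exchange_big /= -[X in (_ <= X * _)%N]card_ord -sum1_card big_distrl /=.
  apply: leq_sum => x _; rewrite mul1n.
  by apply: leq_trans (deliverable_leq s (sh_inj x) (Hd _)) (leq_bigmax _).
have f0 : 0 < L`!%:R :> R by rewrite ltr0n fact_gt0.
rewrite -(ler_pM2l f0) -!natrM; move: bound; rewrite -(ler_nat R); apply: le_trans.
rewrite natr_sum big_distrr /=; apply: ler_sum => n _.
rewrite natr_sum big_distrr /=; apply: ler_sum => i _.
exact: sum_perm_users.
Qed.

Lemma sum_card_placement (B : nat) (p : placement N B L) :
  (\sum_(n < N) \sum_(i < B) #|p n i| = \sum_(l < L) cache_size p l)%N.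
Proof.
rewrite pair_big /=.
under eq_bigr => x _ do rewrite -sum1_card big_mkcond.
rewrite exchange_big /=; apply: eq_bigr => l _.
by rewrite /cache_size -sum1dep_card -big_mkcond.
Qed.

Lemma interp_le (R : realType) (M r : R) (t : nat) :
  (t < L)%N -> (K <= N)%N -> (0 < N)%N ->
  achievable_load N conn M r -> interp L N Kv t M <= r.
Proof.
move=> tL KN N0 [B [p [Ls [B0 [cs [Hd ->]]]]]].
have L0 : 0 < L%:R :> R by rewrite ltr0n; lia.
have N0' : 0 < N%:R :> R by rewrite ltr0n.
have B0' : 0 < B%:R :> R by rewrite ltr0n.
set c := cornerR R L Kv.
(* With a nonpositive slope, the upper bound on storage becomes a lower bound on the load. *)
have D0 : c t.+1 - c t <= 0 by rewrite subr_le0; exact: cornerR_decr.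
have cs' : (\sum_(n < N) \sum_(i < B) #|p n i|)%:R <= L%:R * (M * B%:R).
  rewrite sum_card_placement natr_sum -[X in _ <= X%:R * _](card_ord L) -sum1_card natr_sum.
  rewrite big_distrl; apply: ler_sum => l _; rewrite /= mul1r; exact: cs.
(* Each bit's corner value is replaced by the chord through [t] and [t.+1]; as this is affine in the
   number of caches, only the total storage enters. *)
have main : N%:R * B%:R * (c t - t%:R * (c t.+1 - c t))
    + (\sum_(n < N) \sum_(i < B) #|p n i|)%:R * (c t.+1 - c t) <= N%:R * (\max_d Ls d)%:R.
  refine (le_trans _ (converse_sum R KN N0 Hd)).
  have -> : N%:R * B%:R * (c t - t%:R * (c t.+1 - c t)) =
    \sum_(n < N) \sum_(i < B) (c t - t%:R * (c t.+1 - c t)).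
    by rewrite !sumr_const !card_ord -[RHS]mulr_natl -[(_ - _) *+ B]mulr_natl mulrA.
  rewrite natr_sum big_distrl -big_split; apply: ler_sum => n _.
  rewrite natr_sum big_distrl -big_split; apply: ler_sum => i _ /=.
  have /(_ t #|p n i| tL) := @convex_tangent R L c (@cornerR_shape R L Kv).
  move=> /(_ _)/wrap[]; first by rewrite -[X in (_ <= X)%N]card_ord max_card.
  rewrite -/(c _); move: (c _) (c _) (c _) => x y z; lra.
have := ler_wnM2r D0 cs' => m2.
rewrite ler_pdivlMr // /interp -/c /cornerM.
rewrite -(ler_pM2l N0'); apply: le_trans main; move: m2.
have -> : N%:R * ((c t + (M - t%:R * N%:R / L%:R) / (t.+1%:R * N%:R / L%:R - t%:R * N%:R / L%:R)
      * (c t.+1 - c t)) * B%:R) = N%:R * B%:R * (c t - t%:R * (c t.+1 - c t))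
      + L%:R * (M * B%:R) * (c t.+1 - c t).
  rewrite -natr1; field; apply/andP; split; apply/eqP; nra.
lra.
Qed.
End Converse.

(** * Coded delivery *)

(** On an actual view of [U], the defaults [false] occur only when [U] misses [p n i]. *)
Definition read_bit N B L (p : placement N B L) (U : {set 'I_L})
    (v : 'I_L -> option ('I_N -> 'I_B -> option bool)) (n : 'I_N) (i : 'I_B) : bool :=
  if [pick l in U :&: p n i] is Some l then
    if v l is Some c then odflt false (c n i) else false
  else false.

Lemma read_bitE N B L (p : placement N B L) (W : library N B) (U : {set 'I_L}) n i :
  U :&: p n i != set0 -> read_bit p U (user_view p W U) n i = W n i.
Proof.
rewrite /read_bit => /set0Pn[l0 l0P].
case: pickP => [l|/(_ l0)]; last by rewrite l0P.
by rewrite inE /user_view /cache_content => /andP[-> ->].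
Qed.

(* One coded bit per key: the sum of all requested bits with that key. *)
Lemma xor_deliverable N B L K (Q : eqType) (p : placement N B L)
    (conn : 'I_K -> {set 'I_L}) (d : {ffun 'I_K -> 'I_N})
    (key : 'I_K * 'I_B -> Q) (keys : seq Q) :
  let needed (x : 'I_K * 'I_B) := conn x.1 :&: p (d x.1) x.2 == set0 in
  (forall x, needed x -> key x \in keys) ->
  (forall x y, needed x -> needed y -> key x = key y -> x != y ->
     conn x.1 :&: p (d y.1) y.2 != set0) ->
  deliverable p conn d (size keys).
Proof.
move=> needed keyP cacheP.
exists (fun W q => \big[addb/false]_(x | needed x && (key x == tnth (in_tuple keys) q))
          W (d x.1) x.2).
exists (fun u X v i =>
  if needed (u, i) then
    (if [pick q | tnth (in_tuple keys) q == key (u, i)] is Some q then X q else false)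
    (+) \big[addb/false]_(x | (needed x && (key x == key (u, i))) && (x != (u, i)))
          read_bit p (conn u) v (d x.1) x.2
  else read_bit p (conn u) v (d u) i).
move=> W u i; case: ifPn => [nd|nd]; last exact: read_bitE.
case: pickP => [q /eqP ->|nq]; last first.
  have /tnthP[q e] : key (u, i) \in in_tuple keys by exact: keyP.
  by move: (nq q); rewrite -e eqxx.
rewrite (bigD1 (u, i)) ?nd ?eqxx //= -addbA.
rewrite [X in _ (+) (X (+) _)](eq_bigr (fun x => read_bit p (conn u) (user_view p W (conn u)) (d x.1) x.2)).
  by rewrite addbb addbF.
move=> x /andP[/andP[nx /eqP kx] xu]; rewrite read_bitE //.
by apply: (cacheP (u, i) x) => //; rewrite eq_sym.
Qed.

(** Serves both as the bit labels of a file, [w n] being the size of a subfile stored in [n] caches,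
    and as the first components of keys. *)
Definition sized_pairs (T : finType) (w : nat -> nat) : seq ({set T} * nat) :=
  [seq (A, j) | A : {set T} <- enum {set T}, j <- iota 0 (w #|A|)].

Lemma size_sized_pairs (T : finType) (w : nat -> nat) :
  size (sized_pairs T w) = (\sum_(0 <= n < #|T|.+1) 'C(#|T|, n) * w n)%N.
Proof.
rewrite -sum_nat_by_card size_allpairs_dep sumnE big_map big_enum /=.
by apply: eq_big => [S|S _]; rewrite ?inE // size_iota.
Qed.

Lemma sized_pairs_uniq (T : finType) (w : nat -> nat) : uniq (sized_pairs T w).
Proof.
apply: allpairs_uniq_dep; [exact: enum_uniq|by move=> *; exact: iota_uniq|].
by move=> [? ?] [? ?] _ _ [-> ->].
Qed.

Lemma mem_sized_pairs (T : finType) (w : nat -> nat) S j :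
  ((S, j) \in sized_pairs T w) = (j < w #|S|)%N.
Proof.
apply/allpairsPdep/idP => [[S' [j' [_ + [-> ->]]]]|jw]; first by rewrite mem_iota.
by exists S, j; rewrite mem_enum inE mem_iota.
Qed.

(** In a key, [S] is the union of the user's caches and the bit's caches, [k] ranks users with equal
    caches, [s] is the number of the bit's caches and [j] its index in the subfile. The factor
    [s <= n] guards against truncation of [n - s]. *)
Definition coded_keys (L : nat) (w Kv : nat -> nat) : seq (({set 'I_L} * nat) * (nat * nat)) :=
  flatten [seq [seq (x, (s, j)) | x <- sized_pairs 'I_L (fun n => (s <= n) * Kv (n - s))%N,
      j <- iota 0 (w s)] | s <- iota 0 L.+1].

Lemma size_coded_keys (L : nat) (w Kv : nat -> nat) :
  size (coded_keys L w Kv) =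
  (\sum_(0 <= s < L.+1) w s * \sum_(0 <= l < L.+1) Kv l * 'C(L, s + l))%N.
Proof.
rewrite size_flatten /shape -map_comp sumnE big_map; apply: eq_big_seq => s.
rewrite mem_iota add0n => /andP[_]; rewrite ltnS => sL.
rewrite /= size_allpairs size_iota size_sized_pairs card_ord mulnC; congr (_ * _)%N.
rewrite (@big_cat_nat _ _ _ s) //=; last exact: leqW.
rewrite big1_seq ?add0n; last first.
  by move=> n; rewrite mem_index_iota => /andP[_ /andP[_ h]]; rewrite leqNgt h mul0n muln0.
rewrite -{1}[s]add0n big_addn [RHS](@big_cat_nat _ _ _ (L.+1 - s)) ?leq_subr //=.
rewrite [X in (_ = _ + X)%N]big1_seq ?addn0; last first.
  move=> l; rewrite mem_index_iota => /andP[_ /andP[h _]].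
  by rewrite bin_small ?muln0 //; lia.
by apply: eq_bigr => l _; rewrite leq_addl addnK mul1n mulnC addnC.
Qed.

Lemma mem_coded_keys (L : nat) (w Kv : nat -> nat) (S : {set 'I_L}) k s j :
  (s <= #|S|)%N -> (k < Kv (#|S| - s))%N -> (j < w s)%N ->
  ((S, k), (s, j)) \in coded_keys L w Kv.
Proof.
move=> sS kK jw; apply/flatten_mapP; exists s.
  by rewrite mem_iota /= ltnS (leq_trans sS) // -[X in (_ <= X)%N]card_ord max_card.
by apply/allpairsP; exists ((S, k), j); rewrite mem_sized_pairs sS mul1n mem_iota.
Qed.

Section Achievability.
Variables (L N K : nat) (Kv w : nat -> nat) (conn : 'I_K -> {set 'I_L}).
Hypothesis connE : forall U : {set 'I_L}, #|[set u | conn u == U]| = Kv #|U|.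

Let bits := sized_pairs 'I_L w.
Let B := size bits.
Let lab (i : 'I_B) := tnth (in_tuple bits) i.
Let p : placement N B L := fun _ i => (lab i).1.

Let lab_inj : injective lab.
Proof.
move=> i j; rewrite /lab (tnth_nth (set0, 0%N)) (tnth_nth (set0, 0%N)) => /eqP.
by rewrite nth_uniq ?sized_pairs_uniq // => /eqP /val_inj.
Qed.

(** Separates users with the same caches, whose bits must not share a key. *)
Let rank (u : 'I_K) := index u (enum [set v | conn v == conn u]).

Let rank_lt u : (rank u < Kv #|conn u|)%N.
Proof. by rewrite -connE cardE index_mem mem_enum inE. Qed.

Let rank_inj u v : conn u = conn v -> rank u = rank v -> u = v.
Proof.
rewrite /rank => e; rewrite e => h.
rewrite -(nth_index u (x := u) (s := enum [set v' | conn v' == conn v])) ?mem_enum ?inE ?e //.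
by rewrite h nth_index // mem_enum inE.
Qed.

(** Needed bits with one key have user sets of equal size. If one user set misses the other bit's
    caches, it lies in the other user set, so they coincide; then labels and ranks agree too, and
    the two bits are the same. *)
Lemma coded_deliverable (d : {ffun 'I_K -> 'I_N}) :
  deliverable p conn d (size (coded_keys L w Kv)).
Proof.
pose key (x : 'I_K * 'I_B) := ((conn x.1 :|: (lab x.2).1, rank x.1), (#|(lab x.2).1|, (lab x.2).2)).
have cardU (A C : {set 'I_L}) : A :&: C == set0 -> #|A :|: C| = (#|A| + #|C|)%N.
  by move=> /eqP e; rewrite cardsU e cards0 subn0.
apply: (@xor_deliverable _ _ _ _ _ _ _ _ key) => [[u i]|[u i] [v j]] /=.
  rewrite /p /key /= => /cardU c; apply: mem_coded_keys; rewrite ?c ?leq_addl ?addnK //.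
  by rewrite -(mem_sized_pairs (T := 'I_L)) -surjective_pairing mem_tnth.
rewrite /p /= => nu nv [eS er et ej] neq; apply/negP => nuv; case/negP: neq.
have eU : conn u = conn v.
  have cuv : #|conn u| = #|conn v|.
    by have := cardU _ _ nu; rewrite eS (cardU _ _ nv) et => /addIn.
  apply/eqP; rewrite eqEcard cuv leqnn andbT; apply/subsetP => x xu.
  have : x \in conn v :|: (lab j).1 by rewrite -eS inE xu.
  rewrite inE => /orP[//|xj]; move/eqP/setP/(_ x): nuv.
  by rewrite !inE xu xj.
have eT (A C E : {set 'I_L}) : A :&: C == set0 -> A :|: C = E -> C = E :\: A.
  move=> /eqP/setP dAC <-; apply/setP => x; move: (dAC x); rewrite !inE.
  by case: (x \in A); case: (x \in C).
apply/eqP; congr (_, _); first exact: rank_inj.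
apply: lab_inj; rewrite [LHS]surjective_pairing [RHS]surjective_pairing ej; congr (_, _).
by rewrite (eT _ _ _ nu eS) eU; symmetry; apply: eT nv erefl.
Qed.

(** Transpositions of caches show that all caches are equally full; summing over them counts each
    stored bit once per cache. *)
Lemma coded_cache_size (l : 'I_L) :
  (L * cache_size p l = N * \sum_(0 <= s < L.+1) 'C(L, s) * (s * w s))%N.
Proof.
have sum_bits (h : {set 'I_L} -> nat) :
    (\sum_(i < B) h (lab i).1 = \sum_(S : {set 'I_L}) h S * w #|S|)%N.
  rewrite -(big_tnth _ _ _ xpredT (fun x : {set 'I_L} * nat => h x.1)) /= /bits /sized_pairs.
  rewrite big_allpairs_dep big_enum /=; apply: eq_big => [S|S _]; first by rewrite inE.
  rewrite -[w _ in RHS](size_iota 0) -sum1_size big_distrr; apply: eq_bigr => j _ /=; exact: esym (muln1 _).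
pose c l' := (\sum_(S : {set 'I_L}) (l' \in S) * w #|S|)%N.
have csE : cache_size p l = (N * c l)%N.
  rewrite /cache_size -sum1_card big_mkcond /=.
  rewrite (eq_bigr (fun x : 'I_N * 'I_B => (l \in (lab x.2).1 : nat))); last first.
    by move=> [n i] _; rewrite inE /p /=; case: (l \in _).
  rewrite -(pair_bigA _ (fun (n : 'I_N) (i : 'I_B) => (l \in (lab i).1 : nat))) /=.
  by rewrite sum_nat_const card_ord (sum_bits (fun S => l \in S : nat)).
have c_const l' : c l' = c l.
  rewrite /c (reindex_inj (imset_inj (@perm_inj _ (tperm l l')))); apply: eq_bigr => S _.
  rewrite card_imset; last exact: perm_inj.
  by rewrite -{1}(tpermL l l') mem_imset //; exact: perm_inj.
rewrite csE mulnCA; congr (_ * _)%N.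
transitivity (\sum_(l' < L) c l')%N.
  by rewrite (eq_bigr _ (fun i _ => c_const i)) sum_nat_const card_ord.
rewrite exchange_big /= -[in RHS](card_ord L) -(sum_nat_by_card _ (fun s => s * w s)%N).
apply: eq_bigr => S _; rewrite -big_distrl /=; congr (_ * _)%N.
by rewrite -sum1_card [RHS]big_mkcond; apply: eq_bigr => x _; case: (x \in S).
Qed.

(** An upper bound on the load is enough for the infimum and covers an empty set of demands, where
    the maximum is 0. *)
Lemma achievable_coded (R : realType) (M : R) : (0 < B)%N ->
  N%:R * (\sum_(0 <= s < L.+1) 'C(L, s) * (s * w s))%:R <= L%:R * (M * B%:R) ->
  exists2 r, achievable_load N conn M r &
    r <= (size (coded_keys L w Kv))%:R / B%:R.
Proof.
move=> B0 hM.
exists ((\max_(d : {ffun 'I_K -> 'I_N}) size (coded_keys L w Kv))%:R / B%:R); last first.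
  rewrite ler_pM2r ?invr_gt0 ?ltr0n // ler_nat; exact/bigmax_leqP.
exists B, p, (fun _ => size (coded_keys L w Kv)); split=> //; split=> [l|].
  have L0 : 0 < L%:R :> R by rewrite ltr0n; case: (L) l => [[]|].
  by rewrite -(ler_pM2l L0) -natrM coded_cache_size natrM.
by split=> // d; exact: coded_deliverable.
Qed.

End Achievability.

(** * Memory sharing *)

Lemma sum_two_points (L t : nat) (w G : nat -> nat) : (t < L)%N ->
  (forall s, s != t -> s != t.+1 -> w s = 0%N) ->
  (\sum_(0 <= s < L.+1) w s * G s = w t * G t + w t.+1 * G t.+1)%N.
Proof.
move=> tL w0; rewrite big_mkord.
have tL1 : (t < L.+1)%N by exact: ltnW.
rewrite (bigD1 (Ordinal tL1)) //= (bigD1 (Ordinal (tL : t.+1 < L.+1)%N)) /=; last first.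
  by rewrite -val_eqE /= eqn_leq ltnn.
rewrite big1 ?addn0 // => s; rewrite -!val_eqE /= => /andP[h1 h2].
by rewrite w0.
Qed.

Lemma memory_sharing (R : realType) (L N K : nat) (Kv : nat -> nat)
    (conn : 'I_K -> {set 'I_L}) (t n1 n2 : nat) (M : R) :
  (forall U : {set 'I_L}, #|[set u | conn u == U]| = Kv #|U|) ->
  (t < L)%N -> (0 < n1 + n2)%N ->
  N%:R * (t%:R * n1%:R + t.+1%:R * n2%:R) <= L%:R * M * (n1 + n2)%:R ->
  exists2 r, achievable_load N conn M r &
    r <= (n1%:R * cornerR R L Kv t + n2%:R * cornerR R L Kv t.+1) / (n1 + n2)%:R.
Proof.
move=> connE tL n0 hM.
(* The crossed binomials give the two layers [n1] and [n2] times the same number of bits,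
   ['C(L, t) * 'C(L, t.+1)]. *)
pose w s := (if s == t then n1 * 'C(L, t.+1) else if s == t.+1 then n2 * 'C(L, t) else 0)%N.
have wt : w t = (n1 * 'C(L, t.+1))%N by rewrite /w eqxx.
have wt1 : w t.+1 = (n2 * 'C(L, t))%N by rewrite /w eqxx eqn_leq ltnn.
have w0 s : s != t -> s != t.+1 -> w s = 0%N by rewrite /w => /negPf-> /negPf->.
have Ct : (0 < 'C(L, t))%N by rewrite bin_gt0 ltnW.
have Ct1 : (0 < 'C(L, t.+1))%N by rewrite bin_gt0.
have Bsz : size (sized_pairs 'I_L w) = ((n1 + n2) * ('C(L, t) * 'C(L, t.+1)))%N.
  rewrite size_sized_pairs card_ord.
  under eq_bigr => s _ do rewrite mulnC.
  rewrite (sum_two_points _ tL w0) wt wt1; ring.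
have Msz : (\sum_(0 <= s < L.+1) 'C(L, s) * (s * w s) =
    (t * n1 + t.+1 * n2) * ('C(L, t) * 'C(L, t.+1)))%N.
  under eq_bigr => s _ do rewrite mulnA mulnC.
  rewrite (sum_two_points _ tL w0) wt wt1; ring.
have B0 : (0 < size (sized_pairs 'I_L w))%N by rewrite Bsz !muln_gt0 n0 Ct.
have [|r ar rle] := achievable_coded connE (R := R) (M := M) B0 (N := N).
  rewrite Bsz Msz natrM mulrA [X in _ <= X]mulrA [X in _ <= _ * X]natrM mulrA.
  by apply: ler_wpM2r => //; rewrite natrD !natrM.
exists r => //; apply: le_trans rle _; rewrite le_eqVlt; apply/orP; left; apply/eqP.
have sumE s : (s <= L)%N -> (\sum_(0 <= l < L.+1) Kv l * 'C(L, s + l))%:R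
    = 'C(L, s)%:R * cornerR R L Kv s.
  move=> sL; rewrite cornerRE natr_sum big_distrr; apply: eq_bigr => l _ /=.
  rewrite /binom_ratio natrM; field; by rewrite pnatr_eq0 -lt0n bin_gt0.
rewrite size_coded_keys (sum_two_points _ tL w0) wt wt1 Bsz.
rewrite natrD !natrM !sumE //; last exact: ltnW.
have nz m : (0 < m)%N -> m%:R != 0 :> R by rewrite pnatr_eq0 lt0n.
by field; rewrite -natrD !nz.
Qed.

(** * Matching the two bounds on each interval between corners *)

Theorem theorem1 (R : realType) (Lam N K : nat) (Kv : nat -> nat)
  (conn : 'I_K -> {set 'I_Lam}) :
  (1 <= Lam)%N ->
  K = (\sum_(l < Lam.+1) Kv l * 'C(Lam, l))%N ->
  (K <= N)%N ->
  (forall U : {set 'I_Lam}, #|[set u | conn u == U]| = Kv #|U|) ->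
  forall (t : nat) (M : R), (t < Lam)%N ->
    @cornerM R Lam N t <= M <= @cornerM R Lam N t.+1 ->
    is_inf (@achievable_load R Lam N K conn M) (@interp R Lam N Kv t M).
Proof.
move=> L1 KE KN connE t M tL /andP[lM uM].
have L0 : 0 < Lam%:R :> R by rewrite ltr0n.
have N_ge0 : 0 <= N%:R :> R by [].
split=> [r ar|e e0].
  (* With no files there are no users, so all corner values vanish and nonnegativity of loads
     suffices. *)
  have [N0|N0] := posnP N; last exact: (interp_le connE tL KN N0 ar).
  have Kv0 l : (l < Lam.+1)%N -> Kv l = 0%N.
    move=> lL; have /eqP : (\sum_(l < Lam.+1) Kv l * 'C(Lam, l) = 0)%N by rewrite -KE; lia.
    rewrite sum_nat_eq0 => /forallP/(_ (Ordinal lL)) /=.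
    by rewrite muln_eq0 => /orP[/eqP //|]; rewrite eqn0Ngt bin_gt0 -ltnS lL.
  have c0 s : cornerR R Lam Kv s = 0.
    rewrite cornerRE big_mkord big1 // => l _; by rewrite Kv0 // mul0r.
  rewrite /interp !c0 subrr mulr0 addr0.
  by case: ar => B [p [Ls [_ [_ [_ ->]]]]]; rewrite divr_ge0.
set c := cornerR R Lam Kv.
(* Relative position of [M] between the corners; for [N = 0] the division by zero yields 0. *)
pose tau : R := (M - cornerM R Lam N t) / (cornerM R Lam N t.+1 - cornerM R Lam N t).
have dM : cornerM R Lam N t.+1 - cornerM R Lam N t = N%:R / Lam%:R.
  by rewrite /cornerM -natr1 -mulrBl -mulrBl addrAC subrr add0r mul1r.
have step0 : 0 <= N%:R / Lam%:R :> R by rewrite divr_ge0.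
have tau0 : 0 <= tau by apply: divr_ge0; rewrite ?dM ?subr_ge0.
have tau1 : tau <= 1.
  rewrite /tau dM; have [->|N0] := posnP N; first by rewrite mul0r invr0 mulr0.
  by rewrite ler_pdivrMr ?divr_gt0 ?ltr0n // -dM; lra.
have tauM : N%:R * (t%:R + tau) <= Lam%:R * M.
  have [N0|N0] := posnP N.
    by move: lM; rewrite /cornerM N0 mul0r mulr0 mul0r => M0; rewrite mulr_ge0 // ltW.
  have N0' : 0 < N%:R :> R by rewrite ltr0n.
  rewrite le_eqVlt; apply/orP; left; apply/eqP; rewrite /tau dM /cornerM; field.
  by rewrite !gt_eqF.
have cdecr : 0 <= c t - c t.+1 by rewrite subr_ge0; exact: cornerR_decr.
(* Rounding [n * tau] down to [n2] respects the memory and raises the load by at most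
   [(c t - c t.+1) / n], which this [n] keeps below [e]. *)
pose n := (Num.truncn ((c t - c t.+1) / e)).+1.
have hn : c t - c t.+1 < n%:R * e.
  by rewrite -ltr_pdivrMr // truncnS_gt.
pose n2 := Num.truncn (n%:R * tau).
have n0 : 0 < n%:R :> R by rewrite ltr0n.
have [n2le n2gt] : n2%:R <= n%:R * tau /\ n%:R * tau < n2%:R + 1.
  have /truncn_itv : 0 <= n%:R * tau by apply: mulr_ge0.
  by rewrite natr1 => /andP[].
have n2n : (n2 <= n)%N.
  by rewrite -(ler_nat R); apply: le_trans n2le _; rewrite ler_piMr // ltW.
have nE : (n - n2 + n2)%N = n by rewrite subnK.
have nR : (n - n2)%:R = n%:R - n2%:R :> R by rewrite natrB.
have [||r ar rle] := @memory_sharing R Lam N K Kv conn t (n - n2) n2 M connE tL.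
- by rewrite nE.
- rewrite nE nR -natr1; apply: le_trans (_ : n%:R * (N%:R * (t%:R + tau)) <= _); last first.
    by rewrite [X in _ <= X]mulrC; apply: ler_wpM2l => //; exact: ltW.
  have := ler_wpM2l N_ge0 n2le; lra.
exists r; split => //; apply: le_lt_trans rle _.
rewrite nE nR -/c /interp -/c -/tau ltr_pdivrMr //.
have : (n%:R * tau - n2%:R) * (c t - c t.+1) <= 1 * (c t - c t.+1).
  by apply: ler_wpM2r => //; lra.
rewrite mul1r; nra.
Qed.
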